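(* Let $\mathbb{F}_2(x,y)$ be the field of rational functions in two independent variables over $\mathbb{F}_2$. Then the following matrices $A,B,C,D\in SL(2,\mathbb{F}_2(x,y))$ generate a faithful representation of the genus $2$ surface group, where $ABA^{-1}B^{-1}=DCD^{-1}C^{-1}$: \[ A=\begin{pmatrix} \frac{x^8+x^7+x^5+x^4+x^3}{x^6+x^5+1}&\frac{x^{13}+x^{11}+x^2+x+1}{(x^6+x^5+1)(x^5+1)(x^2+x+1)}\\ 1&\frac{x^3}{(x^5+1)(x^2+x+1)}\end{pmatrix}, \] \[ B=\begin{pmatrix} \frac{x^8+x^7+x^2}{(x^7+x^2+1)(x^5+1)}&\frac{x^{12}+x^{10}+x^9+x^5+x^4+x^2+1}{(x^7+x^2+1)(x^5+1)(x^2+x+1)}\\ x^2+x+1&x^2\end{pmatrix}, \] and $D=TAT^{-1}$, $C=TBT^{-1}$ are the conjugates of $A,B$ respectively by $T=\mathrm{diag}(1,y)$. That is, $a\mapsto A$, $b\mapsto B$, $c\mapsto C$, $d\mapsto D$ defines an injective homomorphism from $S_2=\langle a,b,c,d\mid [a,b][c,d]\rangle$ to $SL(2,\mathbb{F}_2(x,y))$.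
   Context: $S_2$ is the fundamental group of the closed orientable surface of genus $2$, and $[u,v]=uvu^{-1}v^{-1}$. *)

(* Defs.v *)
From HB Require Import structures.
From mathcomp Require Import all_boot all_order all_fingroup all_algebra.
From mathcomp Require Import generic_quotient fraction boolp.

Set Implicit Arguments.
Unset Strict Implicit.
Unset Printing Implicit Defensive.

Import GRing.Theory.
Local Open Scope ring_scope.
Local Open Scope quotient_scope.

(* (x, false) stands for the generator x, and (x, true) for its inverse. *)
Definition word (X : choiceType) := seq (X * bool).

Section Words.
Variable X : choiceType.
Implicit Types u v w : word X.

Definition wgen (x : X) : word X := [:: (x, false)].

Definition winv w : word X := rev [seq (l.1, ~~ l.2) | l <- w].

(* [u, v] = u v u^-1 v^-1; MathComp's [~ u, v] is u^-1 v^-1 u v. *)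
Definition wcomm u v : word X := u ++ v ++ winv u ++ winv v.

Variable rels : seq (word X).

(* The congruence generated by free cancellation and r ~ 1 for r in rels. *)
Inductive word_eq : word X -> word X -> Prop :=
| word_eq_refl w : word_eq w w
| word_eq_sym u v : word_eq u v -> word_eq v u
| word_eq_trans v u w : word_eq u v -> word_eq v w -> word_eq u w
| word_eq_cancel u x e v : word_eq (u ++ [:: (x, e); (x, ~~ e)] ++ v) (u ++ v)
| word_eq_relator u r v : r \in rels -> word_eq (u ++ r ++ v) (u ++ v).

Definition word_eqb : rel (word X) := fun u v => `[< word_eq u v >].

Lemma word_eqb_refl : reflexive word_eqb.
Proof. by move=> w; apply/asboolP; exact: word_eq_refl. Qed.

Lemma word_eqb_sym : symmetric word_eqb.
Proof.
by move=> u v; apply/asboolP/asboolP => h; exact: word_eq_sym.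
Qed.

Lemma word_eqb_trans : transitive word_eqb.
Proof.
move=> v u w /asboolP uv /asboolP vw; apply/asboolP.
exact: word_eq_trans uv vw.
Qed.

Canonical word_equiv := EquivRel word_eqb word_eqb_refl word_eqb_sym word_eqb_trans.

Definition presented := {eq_quot word_equiv}.
HB.instance Definition _ : EqQuotient _ word_eqb presented :=
  EqQuotient.on presented.
HB.instance Definition _ := Choice.on presented.

Definition pclass (w : word X) : presented := \pi_presented w.

Lemma pclassP u v : pclass u = pclass v <-> word_eq u v.
Proof.
split=> [/eqmodP/asboolP //|h]; apply/eqmodP; exact/asboolP.
Qed.

Lemma pclass_repr (p : presented) : pclass (repr p) = p.
Proof. exact: reprK. Qed.

Lemma word_eq_ctx s t u v : word_eq u v -> word_eq (s ++ u ++ t) (s ++ v ++ t).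
Proof.
elim=> {u v} [w|u v _|v u w _ uv _ vw|u x e v|u r v rin].
- exact: word_eq_refl.
- exact: word_eq_sym.
- exact: word_eq_trans uv vw.
- by move: (word_eq_cancel (s ++ u) x e (v ++ t)); rewrite -!catA.
- by move: (word_eq_relator (s ++ u) (v ++ t) rin); rewrite -!catA.
Qed.

Lemma word_eq_cat u u' v v' :
  word_eq u u' -> word_eq v v' -> word_eq (u ++ v) (u' ++ v').
Proof.
move=> /(word_eq_ctx [::] v) h1 /(word_eq_ctx u' [::]).
rewrite !cats0; exact: word_eq_trans.
Qed.

Lemma winvK : involutive winv.
Proof.
move=> w; rewrite /winv map_rev revK -map_comp -[RHS]map_id.
by apply: eq_map => -[x e] /=; rewrite negbK.
Qed.

Lemma word_eq_mulwV w : word_eq (w ++ winv w) [::].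
Proof.
elim: w => [|[x e] w IH]; first exact: word_eq_refl.
have -> : ((x, e) :: w) ++ winv ((x, e) :: w)
    = [:: (x, e)] ++ (w ++ winv w) ++ [:: (x, ~~ e)].
  by rewrite /winv map_cons rev_cons -cats1 /= -!catA.
apply: word_eq_trans (word_eq_ctx _ _ IH) _.
exact: (word_eq_cancel [::] x e [::]).
Qed.

Definition pmul (p q : presented) : presented := pclass (repr p ++ repr q).
Definition pone : presented := pclass [::].
Definition pinv (p : presented) : presented := pclass (winv (repr p)).

Lemma pmulE u v : pmul (pclass u) (pclass v) = pclass (u ++ v).
Proof.
by apply/pclassP; apply: word_eq_cat; apply/pclassP; rewrite pclass_repr.
Qed.

Lemma pmulA : associative pmul.
Proof.
move=> p q r; rewrite -(pclass_repr p) -(pclass_repr q) -(pclass_repr r).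
by rewrite !pmulE catA.
Qed.

Lemma pmul1 : left_id pone pmul.
Proof. by move=> p; rewrite -(pclass_repr p) pmulE. Qed.

Lemma pmulr1 : right_id pone pmul.
Proof. by move=> p; rewrite -(pclass_repr p) pmulE cats0. Qed.

Lemma pmulVp : left_inverse pone pinv pmul.
Proof.
move=> p; rewrite -{2}(pclass_repr p) pmulE; apply/pclassP.
by rewrite -{2}(winvK (repr p)); exact: word_eq_mulwV.
Qed.

Lemma pmulpV : right_inverse pone pinv pmul.
Proof.
move=> p; rewrite -{1}(pclass_repr p) pmulE; apply/pclassP.
exact: word_eq_mulwV.
Qed.

HB.instance Definition _ :=
  isGroup.Build presented pmulA pmul1 pmulr1 pmulVp pmulpV.

Definition pgen (x : X) : presented := pclass (wgen x).

End Words.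

Definition gen_a : 'I_4 := @Ordinal 4 0 isT.
Definition gen_b : 'I_4 := @Ordinal 4 1 isT.
Definition gen_c : 'I_4 := @Ordinal 4 2 isT.
Definition gen_d : 'I_4 := @Ordinal 4 3 isT.

Definition S2_relator : word 'I_4 :=
  wcomm (wgen gen_a) (wgen gen_b) ++ wcomm (wgen gen_c) (wgen gen_d).

Definition S2 : groupType := presented [:: S2_relator].

Definition S2_gen (i : 'I_4) : S2 := pgen [:: S2_relator] i.

Record SL (n : nat) (R : comUnitRingType) := MkSL {
  SLval :> 'M[R]_n;
  _ : \det SLval == 1 }.

Section SpecialLinear.
Variables (n : nat) (R : comUnitRingType).

HB.instance Definition _ := [isSub for @SLval n R].
HB.instance Definition _ := [Choice of SL n R by <:].

Implicit Types M N : SL n R.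

Lemma det_SL M : \det M = 1.
Proof. exact/eqP/(valP M). Qed.

Lemma SL_unitmx M : (M : 'M_n) \in unitmx.
Proof. by rewrite unitmxE det_SL unitr1. Qed.

Fact SL_mul_subproof M N : \det (M *m N) == 1.
Proof. by rewrite det_mulmx !det_SL mulr1. Qed.
Fact SL_one_subproof : \det (1%:M : 'M[R]_n) == 1.
Proof. by rewrite det1. Qed.
Fact SL_inv_subproof M : \det (invmx M) == 1.
Proof. by rewrite det_inv det_SL invr1. Qed.

Definition SL_mul M N := MkSL (SL_mul_subproof M N).
Definition SL_one := MkSL SL_one_subproof.
Definition SL_inv M := MkSL (SL_inv_subproof M).

Lemma SL_mulA : associative SL_mul.
Proof. by move=> L M N; apply: val_inj; exact: mulmxA. Qed.
Lemma SL_mul1 : left_id SL_one SL_mul.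
Proof. by move=> M; apply: val_inj; exact: mul1mx. Qed.
Lemma SL_mulr1 : right_id SL_one SL_mul.
Proof. by move=> M; apply: val_inj; exact: mulmx1. Qed.
Lemma SL_mulVM : left_inverse SL_one SL_inv SL_mul.
Proof. by move=> M; apply: val_inj; exact: (mulVmx (SL_unitmx M)). Qed.
Lemma SL_mulMV : right_inverse SL_one SL_inv SL_mul.
Proof. by move=> M; apply: val_inj; exact: (mulmxV (SL_unitmx M)). Qed.

HB.instance Definition _ :=
  isGroup.Build (SL n R) SL_mulA SL_mul1 SL_mulr1 SL_mulVM SL_mulMV.

End SpecialLinear.

(* F_2(x, y), as the fraction field of F_2[x][y]. *)
Definition F2xy : fieldType := {fraction {poly {poly 'F_2}}}.

Definition varx : F2xy := tofrac ('X%:P : {poly {poly 'F_2}}).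
Definition vary : F2xy := tofrac ('X : {poly {poly 'F_2}}).

Definition mx22 (R : Type) (m00 m01 m10 m11 : R) : 'M[R]_2 :=
  \matrix_(i, j) if i == 0 then (if j == 0 then m00 else m01)
                 else (if j == 0 then m10 else m11).

Definition matA : 'M[F2xy]_2 := mx22
  ((varx ^+ 8 + varx ^+ 7 + varx ^+ 5 + varx ^+ 4 + varx ^+ 3) / (varx ^+ 6 + varx ^+ 5 + 1))
  ((varx ^+ 13 + varx ^+ 11 + varx ^+ 2 + varx + 1)
     / ((varx ^+ 6 + varx ^+ 5 + 1) * (varx ^+ 5 + 1) * (varx ^+ 2 + varx + 1)))
  1
  (varx ^+ 3 / ((varx ^+ 5 + 1) * (varx ^+ 2 + varx + 1))).

Definition matB : 'M[F2xy]_2 := mx22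
  ((varx ^+ 8 + varx ^+ 7 + varx ^+ 2) / ((varx ^+ 7 + varx ^+ 2 + 1) * (varx ^+ 5 + 1)))
  ((varx ^+ 12 + varx ^+ 10 + varx ^+ 9 + varx ^+ 5 + varx ^+ 4 + varx ^+ 2 + 1)
     / ((varx ^+ 7 + varx ^+ 2 + 1) * (varx ^+ 5 + 1) * (varx ^+ 2 + varx + 1)))
  (varx ^+ 2 + varx + 1)
  (varx ^+ 2).

Definition matT : 'M[F2xy]_2 := mx22 1 0 0 vary.

Definition matD : 'M[F2xy]_2 := matT *m matA *m invmx matT.
Definition matC : 'M[F2xy]_2 := matT *m matB *m invmx matT.

(* Main.v *)
(* Conjugation by T = diag(1, y) reduces the theorem to three facts.

   (1) In the form A = [[l d, l d^2 - 1], [1, d]],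
   B = [[e/l, (e^2/l - 1)/c], [c, e]], one relation between l, c, d, e makes
   [A, B] = diag(l, 1/l); in characteristic 2 the matrices of the statement are
   of this form.  Hence T centralises [A, B] and [A, B] = [D, C].

   (2) Play ping-pong with the degree in x: a projective vector (u : w) is
   classified by deg u - deg w, and each of A, B, A^-1, B^-1 maps all but one
   class into its own.  So A and B are free generators.  Moreover the points
   (1 : 0) and (0 : 1) have the periodic itineraries (a b a^-1 b^-1)^oo and
   (b a b^-1 a^-1)^oo, so an element of <A, B> fixing one of them is a power of
   [A, B]; all other elements have both off-diagonal entries nonzero.

   (3) S_2 is the amalgam of F(a, b) and F(d, c) along [a, b] = [d, c].  An
   alternating product of elements outside the amalgamated subgroup is not
   scalar, because the off-diagonal entries make its degree in y grow
   (Shalen's argument). *)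

Require Import Defs.
From mathcomp Require Import all_boot all_order all_fingroup all_algebra.
From HB Require Import structures.
From mathcomp Require Import fraction generic_quotient ring zify.

Set Implicit Arguments.
Unset Strict Implicit.
Unset Printing Implicit Defensive.

Import GRing.Theory.
Local Open Scope ring_scope.

(** * Free reduction and evaluation of words *)

Section FreeReduction.
Variable X : choiceType.
Implicit Types (l m : X * bool) (u w : word X).

Definition linv l := (l.1, ~~ l.2).

Lemma linvK : involutive linv.
Proof. by case=> x e; rewrite /linv /= negbK. Qed.

Definition reduced w := sorted (fun l m => m != linv l) w.

Definition reduce_cons l w :=
  if w is m :: w' then if m == linv l then w' else l :: w else [:: l].

Definition reduce w := foldr reduce_cons [::] w.

Lemma reduced_reduce w : reduced (reduce w).
Proof.
elim: w => //= l w; case: (reduce w) => //= m u red_mu.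
by case: ifPn => [_|ne]; [exact: path_sorted red_mu | rewrite /= ne].
Qed.

Section Evaluation.
Local Open Scope group_scope.
Variables (G : groupType) (h : X -> G).

Definition evall l := if l.2 then (h l.1)^-1 else h l.1.
Definition evalw w := foldr (fun l g => evall l * g) 1 w.

Lemma evall_inv l : evall (linv l) = (evall l)^-1.
Proof. by case: l => x [] //=; rewrite /evall /= invgK. Qed.

Lemma evalw_cat u v : evalw (u ++ v) = evalw u * evalw v.
Proof. by elim: u => [|l u IH] /=; rewrite ?mul1g // IH mulgA. Qed.

Lemma evalw_rcons w l : evalw (rcons w l) = evalw w * evall l.
Proof. by rewrite -cats1 evalw_cat /= mulg1. Qed.

Lemma evalw_inv w : evalw (winv w) = (evalw w)^-1.
Proof.
elim: w => [|l w IH]; first by rewrite invg1.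
by rewrite /winv /= rev_cons evalw_rcons -/(winv w) IH evall_inv invgM.
Qed.

Lemma evalw_reduce w : evalw (reduce w) = evalw w.
Proof.
elim: w => //= l w <-; case: (reduce w) => //= m u.
by case: eqP => //= ->; rewrite evall_inv mulVKg.
Qed.

Lemma evalw_word_eq (rels : seq (word X)) u v :
  {in rels, forall r, evalw r = 1} -> word_eq rels u v -> evalw u = evalw v.
Proof.
move=> rel1; elim=> {u v} // [u v w _ -> //|u x e v|u r v /rel1 r1].
- rewrite !evalw_cat /= mulg1; have -> := evall_inv (x, e).
  by rewrite mulgV mul1g.
- by rewrite !evalw_cat r1 mul1g.
Qed.

End Evaluation.

Lemma evalw_presented (rels : seq (word X)) w :
  evalw (pgen rels) w = pclass rels w.
Proof.
elim: w => // -[x e] w IH; rewrite [LHS]/= IH -cat1s -pmulE.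
congr (_ * _)%g; case: e => //; apply: (mulgI (pgen rels x)).
rewrite mulgV; apply/esym; rewrite [LHS]pmulE; apply/pclassP.
exact: (word_eq_cancel rels [::] x false [::]).
Qed.

(** * Abstract ping-pong and itineraries *)

Section PingPong.
Variables (V : Type) (act : X * bool -> V -> V) (E : V -> V -> Prop).
Variables (D : V -> Prop) (U : X * bool -> V -> Prop).
Hypothesis E_sym : forall v v', E v v' -> E v' v.
Hypothesis E_trans : forall v v' v'', E v v' -> E v' v'' -> E v v''.
Hypothesis act_E : forall l v v', E v v' -> E (act l v) (act l v').
Hypothesis actK : forall l v, E (act (linv l) (act l v)) v.
Hypothesis U_E : forall l v v', E v v' -> U l v -> U l v'.
Hypothesis U_D : forall l v, U l v -> D v.
Hypothesis U_disj : forall l m v, U l v -> U m v -> l = m.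
Hypothesis U_act : forall l v, D v -> ~ U (linv l) v -> U l (act l v).

Definition actw v w := foldr act v w.

Lemma actw_E v v' w : E v v' -> E (actw v w) (actw v' w).
Proof. by move=> vv'; elim: w => //= l w IH; exact: act_E. Qed.

(** Each letter acts on a point in the region of the letter to its right; reducedness and
    disjointness keep that point out of the region of the inverse letter. *)
Lemma ping_pong l w v : reduced (l :: w) -> D v ->
  ~ U (linv (last l w)) v -> U l (actw v (l :: w)).
Proof.
elim: w l => [|m w IH] l red Dv nU; first exact: U_act.
have /andP[ml red_mw] := red.
have Um := IH m red_mw Dv nU; apply: U_act (U_D Um) _ => /(U_disj Um) eq_ml.
by rewrite eq_ml eqxx in ml.
Qed.

(* Each point [P i] lies in [U (s i)] and [P (nxt i)] is [(s i)^-1 (P i)], so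
   the itinerary of [P i] reads [s i, s (nxt i), s (nxt (nxt i)), ...]; a word
   carrying [P j] to [P i] can therefore be peeled off along the itineraries. *)
Variables (I : Type) (s : I -> X * bool) (P : I -> V) (nxt : I -> I).
Variable Q : I -> I -> word X -> Prop.
Hypothesis s_inj : injective s.
Hypothesis U_P : forall i, U (s i) (P i).
Hypothesis P_nxt : forall i, E (act (linv (s i)) (P i)) (P (nxt i)).
Hypothesis Q_nil : forall i, Q i i [::].
Hypothesis Q_cons : forall i j w, Q (nxt i) j w -> Q i j (s i :: w).
Hypothesis Q_rcons : forall i j w, Q i (nxt j) w -> Q i j (rcons w (linv (s j))).

Lemma itinerary w i j : reduced w -> E (actw (P j) w) (P i) -> Q i j w.
Proof.
(* Letters come off either end of the word, hence the induction on its length. *)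
elim: {w}(size w) {-2}w (leqnn (size w)) i j => [|n IH] w.
  rewrite leqn0 size_eq0 => /eqP-> i j _ /= /U_E /(_ (U_P j)) Uj.
  by rewrite (s_inj (U_disj Uj (U_P i))); exact: Q_nil.
case: w => [|k w] w_n i j red; first exact: IH.
(* If the last letter is not the inverse of [s j], ping-pong puts [P i] in [U k], so the first
   letter is [s i] and is peeled off on the left. Otherwise the last letter is peeled off on the
   right. *)
have [last_j|last_j] := eqVneq (last k w) (linv (s j)); last first.
  move=> Ew; have Uk : U k (P i).
    apply: U_E Ew _; apply: ping_pong red (U_D (U_P j)) _ => /U_disj /(_ (U_P j)).
    by move=> ej; rewrite -ej linvK eqxx in last_j.
  have ek := U_disj Uk (U_P i); subst k; apply/Q_cons/IH => //.
    exact: path_sorted red.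
  apply: E_trans (P_nxt i); apply: E_trans (act_E _ Ew); exact/E_sym/actK.
move: w_n red; rewrite lastI last_j size_rcons => w_n red Ew.
apply/Q_rcons/IH => //.
  by move: red; rewrite /reduced -cats1 => /cat_sorted2[].
apply: E_trans Ew; rewrite /actw foldr_rcons; apply/actw_E/E_sym/P_nxt.
Qed.

End PingPong.
End FreeReduction.

(** * Two-by-two matrices *)

Lemma ord2P (i : 'I_2) : i = 0 \/ i = 1.
Proof. by case: i => [[|[|]]] // ?; [left|right]; apply: val_inj. Qed.

Section Matrices22.
Variable R : comNzRingType.
Implicit Types A B : 'M[R]_2.

Lemma sum_I2 (F : 'I_2 -> R) : \sum_i F i = F 0 + F 1.
Proof. by rewrite big_ord_recl big_ord1; congr (_ + F _); apply: val_inj. Qed.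

Lemma mulmx2E n (A : 'M[R]_2) (B : 'M[R]_(2, n)) i j :
  (A *m B) i j = A i 0 * B 0 j + A i 1 * B 1 j.
Proof. by rewrite mxE sum_I2. Qed.

Lemma matrix2P n (A B : 'M[R]_(2, n)) :
  (forall j, A 0 j = B 0 j) -> (forall j, A 1 j = B 1 j) -> A = B.
Proof.
move=> eq0 eq1; apply/matrixP => i j.
by have [->|->] := ord2P i.
Qed.

Lemma mx22P A B : A 0 0 = B 0 0 -> A 0 1 = B 0 1 ->
  A 1 0 = B 1 0 -> A 1 1 = B 1 1 -> A = B.
Proof.
by move=> *; apply: matrix2P => j; have [->|->] := ord2P j.
Qed.

Lemma mx22E (a b c d : R) :
  ((mx22 a b c d 0 0 = a) * (mx22 a b c d 0 1 = b) *
   (mx22 a b c d 1 0 = c) * (mx22 a b c d 1 1 = d))%type.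
Proof. by rewrite !mxE. Qed.

Lemma det2 A : \det A = A 0 0 * A 1 1 - A 0 1 * A 1 0.
Proof.
rewrite (expand_det_row A 0) sum_I2 /cofactor !det_mx11 !mxE /=.
rewrite expr0 expr1 mul1r mulN1r mulrN.
by congr (_ * A _ _ - _ * A _ _); apply: val_inj.
Qed.

Definition adj22 A := mx22 (A 1 1) (- A 0 1) (- A 1 0) (A 0 0).

Lemma mul_adj22 A : adj22 A *m A = (\det A)%:M.
Proof. by rewrite det2; apply: mx22P; rewrite mulmx2E !mx22E !mxE /=; ring. Qed.

Lemma mul_mx_adj22 A : A *m adj22 A = (\det A)%:M.
Proof. by rewrite det2; apply: mx22P; rewrite mulmx2E !mx22E !mxE /=; ring. Qed.

End Matrices22.

(** * The matrices A and B cleared of denominators *)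

Section Entries.
Variables (R : comNzRingType) (t : R).

Definition numA00 := t ^+ 8 + t ^+ 7 + t ^+ 5 + t ^+ 4 + t ^+ 3.
Definition numA01 := t ^+ 13 + t ^+ 11 + t ^+ 2 + t + 1.
Definition numB00 := t ^+ 8 + t ^+ 7 + t ^+ 2.
Definition numB01 :=
  t ^+ 12 + t ^+ 10 + t ^+ 9 + t ^+ 5 + t ^+ 4 + t ^+ 2 + 1.
Definition den2 := t ^+ 2 + t + 1.
Definition den5 := t ^+ 5 + 1.
Definition den6 := t ^+ 6 + t ^+ 5 + 1.
Definition den7 := t ^+ 7 + t ^+ 2 + 1.

Definition denA := den6 * den5 * den2.
Definition denB := den7 * den5 * den2.

Definition intA := mx22 (numA00 * den5 * den2) numA01 denA (t ^+ 3 * den6).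
Definition intB :=
  mx22 (numB00 * den2) numB01 (den2 * denB) (t ^+ 2 * denB).

(** The adjugate keeps inverse letters polynomial; it is the inverse up to the determinant, which is
    harmless projectively. *)
Definition intL (l : bool * bool) :=
  let M := if l.1 then intB else intA in if l.2 then adj22 M else M.
End Entries.

(** * Ping-pong by the degrees of polynomial coordinates *)

Section DegreePingPong.
Variable R : idomainType.
Local Notation Rx := {poly R}.

Let size_lead := (size_polyXn, size_polyX, size_poly1).

Lemma size_den2 : size (den2 'X : Rx) = 3%N.
Proof. by rewrite /den2; repeat rewrite size_polyDl; rewrite ?size_lead. Qed.
Lemma size_den5 : size (den5 'X : Rx) = 6%N.
Proof. by rewrite /den5; repeat rewrite size_polyDl; rewrite ?size_lead. Qed.
Lemma size_den6 : size (den6 'X : Rx) = 7%N.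
Proof. by rewrite /den6; repeat rewrite size_polyDl; rewrite ?size_lead. Qed.
Lemma size_den7 : size (den7 'X : Rx) = 8%N.
Proof. by rewrite /den7; repeat rewrite size_polyDl; rewrite ?size_lead. Qed.
Lemma size_numA00 : size (numA00 'X : Rx) = 9%N.
Proof. by rewrite /numA00; repeat rewrite size_polyDl; rewrite ?size_lead. Qed.
Lemma size_numA01 : size (numA01 'X : Rx) = 14%N.
Proof. by rewrite /numA01; repeat rewrite size_polyDl; rewrite ?size_lead. Qed.
Lemma size_numB00 : size (numB00 'X : Rx) = 9%N.
Proof. by rewrite /numB00; repeat rewrite size_polyDl; rewrite ?size_lead. Qed.
Lemma size_numB01 : size (numB01 'X : Rx) = 13%N.
Proof. by rewrite /numB01; repeat rewrite size_polyDl; rewrite ?size_lead. Qed.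

Lemma size_mul_pos (p q : Rx) :
  (0 < size p -> 0 < size q -> size (p * q)%R = (size p + size q).-1)%N.
Proof. by rewrite !size_poly_gt0; exact: size_mul. Qed.

Lemma size_intA : [/\ size (intA 'X 0 0 : Rx) = 16%N,
  size (intA 'X 0 1 : Rx) = 14%N, size (intA 'X 1 0 : Rx) = 14%N &
  size (intA 'X 1 1 : Rx) = 10%N].
Proof.
rewrite !mx22E /denA; split; first [exact: size_numA01 |
  repeat rewrite size_mul_pos;
  rewrite ?(size_numA00, size_den5, size_den2, size_den6, size_polyX) //].
Qed.

Lemma size_intB : [/\ size (intB 'X 0 0 : Rx) = 11%N,
  size (intB 'X 0 1 : Rx) = 13%N, size (intB 'X 1 0 : Rx) = 17%N &
  size (intB 'X 1 1 : Rx) = 17%N].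
Proof.
rewrite !mx22E /denB; split; first [exact: size_numB01 |
  repeat rewrite size_mul_pos;
  rewrite ?(size_numB00, size_den5, size_den2, size_den7, size_polyX) //].
Qed.

Implicit Types (l : bool * bool) (v : 'cV[Rx]_2).

(* With [u], [w] the sizes of the two coordinates, [region l u w] says that
   [deg u - deg w] is [>= 1], [<= -3], [-2], [0] for [l] the letter [a], [b],
   [a^-1], [b^-1] respectively. *)
Definition region l (u w : nat) : bool :=
  match l with
  | (false, false) => (w < u)%N
  | (true, false) => (0 < w)%N && ((u == 0%N) || (u + 3 <= w)%N)
  | (false, true) => (0 < u)%N && (u + 2 == w)%N
  | (true, true) => (0 < u)%N && (u == w)%N
  end.

Definition in_region l v := region l (size (v 0 0)) (size (v 1 0)).

(** Proportionality over the fraction field, with the multipliers kept polynomial. *)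
Definition proj_eq v v' := exists s t : Rx, [/\ s != 0, t != 0 & s *: v = t *: v'].

Lemma proj_eq_sym v v' : proj_eq v v' -> proj_eq v' v.
Proof. by case=> s [t [s0 t0 e]]; exists t, s. Qed.

Lemma proj_eq_trans v v' v'' : proj_eq v v' -> proj_eq v' v'' -> proj_eq v v''.
Proof.
move=> [s [t [s0 t0 e]]] [s' [t' [s0' t0' e']]].
exists (s' * s), (t * t'); rewrite !mulf_neq0 //; split=> //.
by rewrite -!scalerA e -e' !scalerA mulrC.
Qed.

Lemma proj_eq_scale s v : s != 0 -> proj_eq (s *: v) v.
Proof. by move=> s0; exists 1, s; rewrite oner_neq0 scale1r. Qed.

Lemma proj_eq_mulmx (M : 'M_2) v v' : proj_eq v v' -> proj_eq (M *m v) (M *m v').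
Proof.
by case=> s [t [s0 t0 e]]; exists s, t; split=> //; rewrite !scalemxAr e.
Qed.

(** Together with [size_add_spec], this turns statements on polynomials into linear constraints on
    sizes for [lia]. A zero factor needs its own case, its size being 0. *)
Lemma size_mul_spec (p q : Rx) : (0 < size p)%N ->
  (size q = 0%N /\ size (p * q)%R = 0%N) \/
  (0 < size q)%N /\ (size (p * q)%R).+1 = (size p + size q)%N.
Proof.
move=> p0; have [->|q0] := eqVneq q 0; first by rewrite mulr0 size_poly0; left.
by rewrite -size_poly_gt0 in q0; right; rewrite size_mul_pos // prednK // addn_gt0 p0.
Qed.

Lemma size_add_spec (p q : Rx) :
  [/\ (size (p + q)%R <= maxn (size p) (size q))%N,
      (size q < size p)%N -> size (p + q)%R = size p &
      (size p < size q)%N -> size (p + q)%R = size q].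
Proof.
split; [exact: size_polyD | exact: size_polyDl | by rewrite addrC; exact: size_polyDl].
Qed.

(** A common nonzero factor shifts both degrees equally, so their difference and the vanishing of a
    coordinate are unaffected. *)
Lemma in_region_proj l v v' : proj_eq v v' -> in_region l v -> in_region l v'.
Proof.
case=> s [t [s0 t0 e]]; move: s0 t0; rewrite -!size_poly_gt0 => s0 t0.
have e0 : s * v 0 0 = t * v' 0 0.
  by have := congr1 (fun M : 'cV_2 => M 0 0) e; rewrite !mxE.
have e1 : s * v 1 0 = t * v' 1 0.
  by have := congr1 (fun M : 'cV_2 => M 1 0) e; rewrite !mxE.
have := size_mul_spec (v 0 0) s0; have := size_mul_spec (v 1 0) s0.
have := size_mul_spec (v' 0 0) t0; have := size_mul_spec (v' 1 0) t0.
rewrite -e0 -e1 /in_region; move: (size (s * v 0 0)) (size (s * v 1 0)) s0 t0.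
move: (size s) (size t) (size (v 0 0)) (size (v 1 0)) (size (v' 0 0)) (size (v' 1 0)).
by clear; case: l => [[] []] /=; lia.
Qed.

Lemma in_region_neq0 l v : in_region l v -> v != 0.
Proof.
apply: contraTneq => ->; rewrite /in_region !mxE size_poly0.
by case: l => [[] []].
Qed.

Lemma in_region_disj l m v : in_region l v -> in_region m v -> l = m.
Proof. by rewrite /in_region; case: l m => [[] []] [[] []] //= h h'; exfalso; lia. Qed.

(** Leading terms can cancel in a row that decides the region only at a degree difference belonging
    to the region of the inverse letter. For A the top row and for B the bottom row must be exact,
    an upper bound sufficing in the other; for the inverses both rows are exact. *)
Lemma in_region_act l v : v != 0 ->
  ~ in_region (linv l) v -> in_region l (intL 'X l *m v).
Proof.
move=> v_neq0; have v0 : (0 < size (v 0%R 0%R) + size (v 1%R 0%R))%N.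
  rewrite lt0n addn_eq0 !size_poly_eq0; apply: contra v_neq0 => /andP[/eqP e0 /eqP e1].
  by apply/eqP/matrix2P => j; rewrite [j]ord1 mxE.
have [a00 a01 a10 a11] := size_intA; have [b00 b01 b10 b11] := size_intB.
rewrite /in_region !mulmx2E.
set M := intL 'X l.
have M_gt0 i j : (0 < size (M i j))%N.
  by rewrite /M /intL; case: l {M} => [[] []] /=;
    have [->|->] := ord2P i; have [->|->] := ord2P j;
    rewrite ?[adj22 _ _ _]mxE /= ?size_polyN ?(a00, a01, a10, a11, b00, b01, b10, b11).
have := size_add_spec (M 0 0 * v 0 0) (M 0 1 * v 1 0).
have := size_add_spec (M 1 0 * v 0 0) (M 1 1 * v 1 0).
have := size_mul_spec (v 0 0) (M_gt0 0 0); have := size_mul_spec (v 1 0) (M_gt0 0 1).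
have := size_mul_spec (v 0 0) (M_gt0 1 0); have := size_mul_spec (v 1 0) (M_gt0 1 1).
move: (size (M 0 0 * v 0 0 + M 0 1 * v 1 0)) (size (M 1 0 * v 0 0 + M 1 1 * v 1 0)).
move: (size (M 0 0 * v 0 0)) (size (M 0 1 * v 1 0)).
move: (size (M 1 0 * v 0 0)) (size (M 1 1 * v 1 0)).
move: (size (v 0 0)) (size (v 1 0)) v0; rewrite /M /intL {M_gt0}.
case: l {M} => [[] []] /=; rewrite ?[adj22 _ _ _]mxE /= ?size_polyN;
  rewrite ?(a00, a01, a10, a11, b00, b01, b10, b11).
all: by move=> u w ? p q r s e f h1 h2 h3 h4 [h5 h6 h7] [h8 h9 h10]; lia.
Qed.

(** For A and B the antidiagonal product has larger degree than the diagonal one. *)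
Lemma det_intL_neq0 l : \det (intL 'X l : 'M[Rx]_2) != 0.
Proof.
suff d0 (b : bool) : \det (intL 'X (b, false) : 'M[Rx]_2) != 0.
  case: l => b []; rewrite ?d0 //; move: (d0 b); rewrite /intL /= !det2 !mx22E.
  by rewrite mulrC mulrNN.
rewrite det2 -size_poly_gt0 addrC size_polyDl size_polyN.
  have [_ a01 a10 _] := size_intA; have [_ b01 b10 _] := size_intB.
  by case: b => /=; rewrite size_mul_pos ?(a01, a10, b01, b10).
have [a00 a01 a10 a11] := size_intA; have [b00 b01 b10 b11] := size_intB.
by case: b => /=; rewrite !size_mul_pos ?(a00, a01, a10, a11, b00, b01, b10, b11).
Qed.

Lemma intLK l v : proj_eq (intL 'X (linv l) *m (intL 'X l *m v)) v.
Proof.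
rewrite mulmxA; suff -> : intL 'X (linv l) *m intL 'X l =
    (\det (intL 'X l : 'M[Rx]_2))%:M.
  by rewrite mul_scalar_mx; exact/proj_eq_scale/det_intL_neq0.
case: l => b [] /=; last exact: mul_adj22.
rewrite /intL /= mul_mx_adj22 !det2 !mx22E; congr (_%:M).
by rewrite mulrNN mulrC.
Qed.

Definition intW (w : word bool) : 'M[Rx]_2 :=
  foldr (fun l M => intL 'X l *m M) 1%:M w.

Lemma intW_actw w v : intW w *m v = actw (fun l => mulmx (intL 'X l)) v w.
Proof. by elim: w => [|l w IH] /=; rewrite ?mul1mx // -mulmxA IH. Qed.

Lemma det_intW_neq0 w : \det (intW w) != 0.
Proof.
elim: w => [|l w IH]; first by rewrite det1 oner_neq0.
by rewrite det_mulmx mulf_neq0 ?det_intL_neq0.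
Qed.

Lemma intW_region l w v : reduced (l :: w) -> v != 0 ->
  ~ in_region (linv (last l w)) v -> in_region l (intW (l :: w) *m v).
Proof.
rewrite intW_actw.
exact: (ping_pong (D := fun v => v != 0) in_region_neq0 in_region_disj in_region_act).
Qed.

(* The vector [(1, 'X)] lies in none of the four regions. *)
Lemma intW_not_scalar w c : reduced w -> intW w = c%:M -> w = [::].
Proof.
case: w => // l w red eW; pose v : 'cV[Rx]_2 := \col_i (if i == 0 then 1 else 'X).
have nv m : ~ in_region m v.
  by rewrite /in_region !mxE /= size_poly1 size_polyX; case: m => [[] []].
have v0 : v != 0.
  apply/eqP => /(congr1 (fun M : 'cV_2 => M 0 0)) /eqP.
  by rewrite !mxE oner_eq0.
have c0 : c != 0.
  by have := det_intW_neq0 (l :: w); rewrite eW det_scalar expf_eq0.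
case: (nv l); apply: in_region_proj (intW_region red v0 (@nv _)).
by rewrite eW mul_scalar_mx; exact: proj_eq_scale.
Qed.

(** [a, b] for [false] and its inverse [b, a] for [true]: the period of the itinerary of the
    corresponding coordinate axis. *)
Definition comm_word (g : bool) : word bool :=
  [:: (g, false); (~~ g, false); (g, true); (~~ g, true)].

Definition idx (g : bool) : 'I_2 := if g then 1 else 0.
Definition axis g : 'cV[Rx]_2 := delta_mx (idx g) 0.

(** * Stabilisers of the coordinate axes *)

Section Stabilizer.
Local Open Scope group_scope.
Variables (G : groupType) (h : bool -> bool -> G) (g : bool).
Hypothesis h_comm : evalw (h false) (comm_word g) = evalw (h true) (comm_word g).
Hypothesis axis_comm : proj_eq (intW (comm_word g) *m axis g) (axis g).

(** For [g = true] this exchanges a and b, so that the single itinerary a b a^-1 b^-1 serves both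
    axes. *)
Let letter (i : bool * bool) := (i.1 (+) g, i.2).
Let next (i : bool * bool) := (~~ i.1, i.1 (+) i.2).

(** The part of the period from letter [i] on, applied to the axis. At the first letter the whole
    period is replaced by the empty word, since it fixes the axis projectively. *)
Let point (i : bool * bool) : 'cV[Rx]_2 := intW (map letter
  match i with
  | (false, false) => [::]
  | (true, true) => [:: (true, true)]
  | (false, true) => [:: (false, true); (true, true)]
  | (true, false) => [:: (true, false); (false, true); (true, true)]
  end) *m axis g.

(** The part of the period that precedes letter [i]. *)
Let start (i : bool * bool) : word bool := map letter
  match i with
  | (false, false) => [::]
  | (true, false) => [:: (false, false)]
  | (false, true) => [:: (false, false); (true, false)]
  | (true, true) => [:: (false, false); (true, false); (false, true)]
  end.

Let comm_wordE :
  comm_word g =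
    map letter [:: (false, false); (true, false); (false, true); (true, true)].
Proof. by []. Qed.

Let letter_inj : injective letter.
Proof. by move=> [x e] [y f] [/addIb -> ->]. Qed.

Let letter_inv i : linv (letter i) = letter (linv i).
Proof. by case: i. Qed.

Let in_region_point i : in_region (letter i) (point i).
Proof.
have r0 : in_region (letter (false, false)) (point (false, false)).
  rewrite /point /axis /in_region /= mul1mx !mxE.
  by case: (g); rewrite /= ?size_poly0 ?size_poly1.
have step j m v : in_region (letter m) v -> m != linv j ->
    in_region (letter j) (intL 'X (letter j) *m v).
  move=> mv /eqP mj; apply: in_region_act (in_region_neq0 mv) _.
  by rewrite letter_inv => /(in_region_disj mv) /letter_inj.
have r1 : in_region (letter (true, true)) (point (true, true)).
  by rewrite /point /= -!mulmxA; exact: (step (true, true) (false, false) _ r0).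
have r2 : in_region (letter (false, true)) (point (false, true)).
  by move: r1; rewrite /point /= -!mulmxA => r1;
  exact: (step (false, true) (true, true) _ r1).
case: i => [[] []] //.
by move: r2; rewrite /point /= -!mulmxA => r2;
exact: (step (true, false) (false, true) _ r2).
Qed.

Let point_next i : proj_eq (intL 'X (linv (letter i)) *m point i) (point (next i)).
Proof.
have [->|ne] := eqVneq i (false, false); last first.
  have -> : point i = intL 'X (letter i) *m point (next i).
    by case: i ne => [[] []] //= _; rewrite /point /= -!mulmxA.
  exact: intLK.
(* The first letter is where the itinerary wraps around: here the commutator must fix the axis. *)
apply: (proj_eq_trans _ (intLK (letter (false, false)) _)); rewrite /point /next /=.
apply: proj_eq_mulmx; apply: proj_eq_sym.
by move: axis_comm; rewrite comm_wordE /= -!mulmxA mul1mx.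
Qed.

(** Such a [w] is a power of the commutator in the free group; the conclusion keeps only that
    evaluations agreeing on the commutator agree on [w]. *)
Lemma stabilizer w : reduced w -> proj_eq (intW w *m axis g) (axis g) ->
  evalw (h false) w = evalw (h true) w.
Proof.
pose H k i := evalw (h k) (start i).
(* Prefixing [start i] and removing [start j] turns a path between points of the itinerary into a
   loop at the axis; both evaluations must agree on this loop. *)
pose Q i j u := H false i * evalw (h false) u * (H false j)^-1 =
  H true i * evalw (h true) u * (H true j)^-1.
have H_next i : H false i * evall (h false) (letter i) * (H false (next i))^-1 =
  H true i * evall (h true) (letter i) * (H true (next i))^-1.
  (* The loop of one letter is trivial, except that the last letter closes up the whole period. *)
  have Hs k : H k i * evall (h k) (letter i) * (H k (next i))^-1 =
      if i == (true, true) then evalw (h k) (comm_word g) else 1.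
    rewrite comm_wordE /H -evalw_rcons; case: i => [[] []] /=;
    by rewrite ?invg1 ?mulg1 ?mulgV.
  by rewrite !Hs; case: ifP.
have Q_nil i : Q i i [::] by rewrite /Q /= !mulg1 !mulgV.
have Q_cons i j u : Q (next i) j u -> Q i j (letter i :: u).
  rewrite /Q /= => Qu.
  have split k : H k i * (evall (h k) (letter i) * evalw (h k) u) * (H k j)^-1 =
    (H k i * evall (h k) (letter i) * (H k (next i))^-1) *
    (H k (next i) * evalw (h k) u * (H k j)^-1) by rewrite !mulgA mulgKV.
  by rewrite !split Qu H_next.
have Q_rcons i j u : Q i (next j) u -> Q i j (rcons u (linv (letter j))).
  rewrite /Q => Qu.
  have split k : H k i * evalw (h k) (rcons u (linv (letter j))) * (H k j)^-1 =
    (H k i * evalw (h k) u * (H k (next j))^-1) *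
    (H k j * evall (h k) (letter j) * (H k (next j))^-1)^-1.
    by rewrite evalw_rcons evall_inv !invgM invgK !mulgA mulgKV.
  by rewrite !split Qu H_next.
move=> red fix_w.
have := itinerary proj_eq_sym proj_eq_trans (fun l => @proj_eq_mulmx _)
  intLK in_region_proj in_region_neq0 in_region_disj in_region_act
  letter_inj in_region_point point_next Q_nil Q_cons Q_rcons
  (w := w) (i := (false, false)) (j := (false, false)) red.
rewrite /Q /H /= !mul1g invg1 !mulg1; apply.
by rewrite -intW_actw /point /= !mul1mx.
Qed.

End Stabilizer.

Lemma axis_stable (M : 'M[Rx]_2) g : \det M != 0 ->
  M (idx (~~ g)) (idx g) = 0 -> proj_eq (M *m axis g) (axis g).
Proof.
move=> d0 M0; suff -> : M *m axis g = M (idx g) (idx g) *: axis g.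
  apply: proj_eq_scale; apply: contra d0 => /eqP Mg.
  by rewrite det2; case: g M0 Mg => /= -> ->; rewrite ?mulr0 ?mul0r subr0.
rewrite /axis -colE; apply: matrix2P => j; rewrite [j]ord1 !mxE;
by case: g M0 => /= M0; rewrite ?M0 ?mulr0 ?mulr1.
Qed.

(** A vanishing off-diagonal entry means that an axis is fixed, which [stabilizer] excludes. *)
Lemma intW_offdiag_neq0 (G : groupType) (h : bool -> bool -> G) w :
  (forall g, evalw (h false) (comm_word g) = evalw (h true) (comm_word g)) ->
  (forall g, intW (comm_word g) (idx (~~ g)) (idx g) = 0) ->
  reduced w -> evalw (h false) w != evalw (h true) w ->
  forall g, intW w (idx (~~ g)) (idx g) != 0.
Proof.
move=> h_comm comm0 red ne g; apply: contra ne => /eqP w0; apply/eqP.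
apply: (stabilizer (h_comm g)) red _; apply: axis_stable => //; exact: det_intW_neq0.
Qed.

End DegreePingPong.

(** * Degree growth in y of alternating products *)

Section AlternatingProducts.
Variable K : idomainType.
Implicit Types (a b : {poly K}) (p q r s : K).

(* [true] syllables are conjugated by [diag(1, 'X)], then scaled by ['X] to
   clear the denominator. *)
Definition lift22 (t : bool) (M : 'M[K]_2) : 'M[{poly K}]_2 :=
  if t then mx22 ((M 0 0)%:P * 'X) (M 0 1)%:P ((M 1 0)%:P * 'X^2) ((M 1 1)%:P * 'X)
  else map_mx polyC M.

Definition lift_prod (x : seq (bool * 'M[K]_2)) :=
  foldr (fun y M => lift22 y.1 y.2 *m M) 1%:M x.

Let size_Cmul_le p a : (size (p%:P * a)%R <= size a)%N.
Proof. by rewrite mul_polyC size_scale_leq. Qed.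

Let size_CXmul_le p a : (size (p%:P * 'X * a)%R <= (size a).+1)%N.
Proof.
rewrite -mulrA; apply: leq_trans (size_Cmul_le _ _) _.
by apply: leq_trans (size_polyMleq _ _) _; rewrite size_polyX.
Qed.

Let size_CX2mul_le p a : (size (p%:P * 'X^2 * a)%R <= (size a).+2)%N.
Proof.
rewrite -mulrA; apply: leq_trans (size_Cmul_le _ _) _.
by apply: leq_trans (size_polyMleq _ _) _; rewrite size_polyXn.
Qed.

Let size_CX2mul p a : p != 0 -> (0 < size a)%N ->
  size (p%:P * 'X^2 * a) = (size a).+2.
Proof.
rewrite size_poly_gt0 => p0 a0.
by rewrite -mulrA mul_polyC size_scale // mulrC size_mulXn.
Qed.

Let size_add_le a b m n : (size a <= m)%N -> (size b <= n)%N ->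
  (size (a + b)%R <= maxn m n)%N.
Proof.
by move=> am bn; apply: leq_trans (size_polyD _ _) _; rewrite geq_max !leq_max am bn orbT.
Qed.

(* The entries of column [j], the dominant one, and of the other column [i]. *)
Definition dominated (t : bool) (h : bool) (n0j n1j n0i n1i : nat) := (
  if h then [&& n0j < n1j, n0i + t <= n1j & n1i + t <= n1j]
  else [&& 0 < n0j, n1j <= n0j, n0i + t <= n0j & n1i + t <= n0j.+1])%N.

(** The strict form holds once a syllable has acted, whereas [dominated] must also admit the
    identity matrix, the base of the induction. *)
Definition sdominated (t : bool) (h : bool) (n0j n1j n0i n1i : nat) :=
  dominated t h n0j n1j n0i n1i && (if h then n0i < n1j else n1i + t <= n0j)%N.

Let sizes (P : nat -> nat -> nat -> nat -> bool) (j i : 'I_2) (M : 'M[{poly K}]_2) :=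
  P (size (M 0 j)) (size (M 1 j)) (size (M 0 i)) (size (M 1 i)).

(** The entry responsible for the growth: lower left, which [lift22] multiplies by ['X^2], in a
    [true] syllable, and upper right in a [false] one. *)
Definition offdiag (x : bool * 'M[K]_2) := x.2 (idx x.1) (idx (~~ x.1)) != 0.

(** The [offdiag] entry multiplies the dominant entry of [N], and no other term of that sum reaches
    the same degree; all other entries only need upper bounds. Dominance thus passes to the other
    row. *)
Lemma lift_dominated t h M N j i : offdiag (h, M) ->
  sizes (dominated t (~~ h)) j i N -> sizes (sdominated t h) j i (lift22 h M *m N).
Proof.
rewrite /offdiag /sizes !mulmx2E; case: h => /= M0.
  rewrite !mxE /= => /and4P[h1 h2 h3 h4].
  have e : size ((M 1 0)%:P * 'X^2 * N 0 j + (M 1 1)%:P * 'X * N 1 j) = (size (N 0 j)).+2.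
    rewrite size_polyDl size_CX2mul //.
    by apply: leq_ltn_trans (size_CXmul_le _ _) _; rewrite !ltnS.
  have := size_add_le (size_CXmul_le (M 0 0) (N 0 j)) (size_Cmul_le (M 0 1) (N 1 j)).
  have := size_add_le (size_CXmul_le (M 0 0) (N 0 i)) (size_Cmul_le (M 0 1) (N 1 i)).
  have := size_add_le (size_CX2mul_le (M 1 0) (N 0 i)) (size_CXmul_le (M 1 1) (N 1 i)).
  rewrite e /sdominated /dominated /=; clear e.
  do 3 move: (size (polyseq (_ + _))) => ?.
  move: h1 h2 h3 h4; move: (size (N 0 j)) (size (N 1 j)) (size (N 0 i)) (size (N 1 i)).
  by case: t => /=; lia.
rewrite !mxE /= => /and3P[h1 h2 h3].
have e : size ((M 0 0)%:P * N 0 j + (M 0 1)%:P * N 1 j) = size (N 1 j).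
  have eQ : size ((M 0 1)%:P * N 1 j) = size (N 1 j) by rewrite mul_polyC size_scale.
  by rewrite addrC size_polyDl eQ // (leq_ltn_trans (size_Cmul_le _ _)).
have := size_add_le (size_Cmul_le (M 1 0) (N 0 j)) (size_Cmul_le (M 1 1) (N 1 j)).
have := size_add_le (size_Cmul_le (M 0 0) (N 0 i)) (size_Cmul_le (M 0 1) (N 1 i)).
have := size_add_le (size_Cmul_le (M 1 0) (N 0 i)) (size_Cmul_le (M 1 1) (N 1 i)).
rewrite e /sdominated /dominated /=; clear e.
do 3 move: (size (polyseq (_ + _))) => ?.
move: h1 h2 h3; move: (size (N 0 j)) (size (N 1 j)) (size (N 0 i)) (size (N 1 i)).
by case: t => /=; lia.
Qed.

(** Induction from the right end: the type [t] of the last syllable fixes the dominant column, that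
    of the first syllable the dominant row. *)
Lemma lift_prod_dominated x y : let t := (last x y).1 in
  all offdiag (x :: y) -> sorted (fun u v => u.1 != v.1) (x :: y) ->
  sizes (sdominated t x.1) (idx (~~ t)) (idx t) (lift_prod (x :: y)).
Proof.
elim: y x => [|z y IH] [h M] /= /andP[Mh My] alt.
  rewrite mulmx1 -[lift22 h M]mulmx1; apply: lift_dominated => //.
  by rewrite /sizes !mxE; case: (h); rewrite /= ?size_poly0 ?size_poly1.
move: alt => /andP[hz alt]; apply: lift_dominated => //.
have := IH z My alt; rewrite /sizes.
have ez : z.1 = ~~ h by move: hz; case: h {Mh} (z.1) => [] [].
by rewrite /= ez => /andP[].
Qed.

Lemma lift_prod_not_scalar x c : x != [::] -> all offdiag x ->
  sorted (fun u v => u.1 != v.1) x -> lift_prod x != c%:M.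
Proof.
case: x => // x y _ off alt; apply/eqP => e.
(* In a scalar matrix the dominant entry would lie on the diagonal and have the size of the other
   diagonal entry, against the strict inequality. *)
have := lift_prod_dominated off alt; rewrite e /sizes /sdominated /dominated !mxE.
by case: (x.1); case: ((last x y).1); rewrite /= ?size_poly0; lia.
Qed.

End AlternatingProducts.

(** * Syllable reduction in an amalgam *)

Lemma not_sortedP (T : Type) (r : rel T) (s : seq T) : ~~ sorted r s ->
  exists s1 x y s2, s = s1 ++ [:: x, y & s2] /\ ~~ r x y.
Proof.
elim: s => // x [|y s] //= IH; rewrite negb_and => /orP[nxy|/IH].
  by exists [::], x, y, s.
by move=> [s1 [u [v [s2 [-> nuv]]]]]; exists (x :: s1), u, v, s2.
Qed.

Section Syllables.
Local Open Scope group_scope.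
Variables (X : choiceType) (G : groupType) (h : bool -> X -> G).
Implicit Types (x y : bool * word X) (s : seq (bool * word X)).

Definition syl_val s := foldr (fun x g => evalw (h x.1) x.2 * g) 1 s.

Lemma syl_val_cat s s' : syl_val (s ++ s') = syl_val s * syl_val s'.
Proof. by elim: s => [|x s IH] /=; rewrite ?mul1g // IH mulgA. Qed.

(** Plays the role of membership in the amalgamated subgroup; the two factors share one alphabet, so
    the same word is read on both sides. *)
Definition amalgamated w := evalw (h false) w == evalw (h true) w.

Lemma amalgamatedE t t' w : amalgamated w -> evalw (h t) w = evalw (h t') w.
Proof. by move=> /eqP; case: t t' => [] [] // ->. Qed.

Let mergeable x y := [|| x.1 == y.1, amalgamated x.2 | amalgamated y.2].

(** An amalgamated syllable may be read on the side of its neighbour, so the two fuse. *)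
Let merge_syl x y : mergeable x y -> exists z,
  reduced z.2 /\ evalw (h z.1) z.2 = evalw (h x.1) x.2 * evalw (h y.1) y.2.
Proof.
move=> xy; suff [t [ex ey]] : exists t, evalw (h x.1) x.2 = evalw (h t) x.2 /\
    evalw (h y.1) y.2 = evalw (h t) y.2.
  exists (t, reduce (x.2 ++ y.2)).
  by rewrite reduced_reduce evalw_reduce evalw_cat ex ey.
have [/eqP exy|ax|ay] := or3P xy; first by exists x.1; rewrite exy.
  by exists y.1; rewrite (amalgamatedE x.1 y.1 ax).
by exists x.1; rewrite (amalgamatedE y.1 x.1 ay).
Qed.

(** [P] stands for a kernel. Fusing neighbours shortens the sequence until it is empty, a single
    syllable, or alternating without amalgamated syllables. *)
Lemma syl_val_trivial (P : G -> Prop) :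
  (forall t w, reduced w -> P (evalw (h t) w) -> w = [::]) ->
  (forall s, s != [::] -> all (fun x => reduced x.2) s ->
     all (fun x => ~~ amalgamated x.2) s -> sorted (fun x y => x.1 != y.1) s ->
     ~ P (syl_val s)) ->
  forall s, all (fun x => reduced x.2) s -> P (syl_val s) -> syl_val s = 1.
Proof.
move=> freeP altP s; have [n] := ubnP (size s).
elim: n s => // n IH s; rewrite ltnS => s_n red Ps.
have [srt|/not_sortedP[s1 [x [y [s2 [es]]]]]] :=
  boolP (sorted [rel x y | ~~ mergeable x y] s).
  (* A lone syllable may be amalgamated and is left to [freeP]; from two syllables on,
     non-mergeability with a neighbour rules this out for each. *)
  case: s => [|x [|y s]] // in s_n red Ps srt *.
    have /andP[red_x _] := red; rewrite /= mulg1 in Ps.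
    by rewrite /= (freeP _ _ red_x Ps) mulg1.
  case: (altP [:: x, y & s]) => //.
    elim: s x y {s_n red Ps} srt => [|z s IHs] x y /andP[].
      by rewrite /= !negb_or => /and3P[_ -> ->].
    by move=> + /IHs; rewrite /= !negb_or => /and3P[_ -> _].
  apply: sub_sorted srt => u v /=.
  by rewrite negb_or => /andP[].
rewrite negbK => /merge_syl[z [red_z ez]].
have e : syl_val s = syl_val (s1 ++ z :: s2).
  by rewrite es !syl_val_cat /= ez !mulgA.
rewrite e; apply: IH; last by rewrite -e.
  by move: s_n; rewrite es !size_cat /= !addnS.
by move: red; rewrite es !all_cat /= => /and4P[-> _ _ ->]; rewrite red_z.
Qed.

End Syllables.

Lemma evalw_map (X Y : choiceType) (G : groupType) (k : Y -> G) (f : X -> Y) w :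
  evalw k [seq (f l.1, l.2) | l <- w] = evalw (k \o f) w.
Proof. by elim: w => //= l w ->. Qed.

Lemma evalw_morph (X : choiceType) (G H : groupType) (f : G -> H) (h : X -> G) w :
  {morph f : a b / (a * b)%g} -> f (evalw h w) = evalw (f \o h) w.
Proof.
move=> fM; have f1 : f 1%g = 1%g by apply: (mulgI (f 1%g)); rewrite -fM !mulg1.
have fV a : f a^-1%g = (f a)^-1%g.
  by apply: (mulgI (f a)); rewrite -fM !mulgV.
elim: w => //= -[l [] ] w IH; rewrite fM IH //= /evall /=.
by rewrite fV.
Qed.

(** * Polynomial identities in characteristic 2 *)

Section CharacteristicTwo.
Variables (R : comNzRingType) (t : R).
Hypothesis char2 : 2%:R = 0 :> R.

(** Lifts an identity to integer coefficients, where [ring] applies; each witness [c] below is half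
    the difference of the two sides there. *)
Let eq_mod2 (a b c : R) : a = b + 2%:R * c -> a = b.
Proof. by rewrite char2 mul0r addr0. Qed.

Lemma numA00E : numA00 t * den2 t = t ^+ 3 * den7 t.
Proof.
apply: (@eq_mod2 _ _ (t ^+ 4 + t ^+ 5 + t ^+ 6 + t ^+ 7 + t ^+ 8 + t ^+ 9)).
by rewrite /numA00 /den2 /den7; ring.
Qed.

Lemma numA01E : numA01 t = numA00 t * t ^+ 3 - denA t.
Proof.
apply: (@eq_mod2 _ _ (1 + t + t ^+ 2 + t ^+ 5 + t ^+ 6 + t ^+ 7 + t ^+ 11
  + t ^+ 12 + t ^+ 13)).
by rewrite /numA01 /numA00 /denA /den6 /den5 /den2; ring.
Qed.

Lemma numB01E : numB01 t = t ^+ 4 * den6 t - den7 t * den5 t.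
Proof.
apply: (@eq_mod2 _ _ (1 + t ^+ 2 + t ^+ 5 + t ^+ 7 + t ^+ 12)).
by rewrite /numB01 /den7 /den6 /den5; ring.
Qed.

(** For c = [den2 t], d = t^3 / ([den5 t] c) and e = t^2, this says c^2 + e^2 - cde =
    [den7 t / den5 t]. *)
Lemma den7E : den7 t = (den2 t ^+ 2 + t ^+ 4) * den5 t - t ^+ 5.
Proof.
apply: (@eq_mod2 _ _ (- (t + t ^+ 2 + t ^+ 3 + t ^+ 4 +
   t ^+ 6 + t ^+ 7 + t ^+ 8 + t ^+ 9))).
by rewrite /den7 /den2 /den5; ring.
Qed.

End CharacteristicTwo.

(** With the same c, d, e: (cd)^2 - cde + 1 = [den6 t / den5 t ^+ 2]. *)
Lemma den6E (R : comNzRingType) (t : R) :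
  den6 t = t ^+ 6 - t ^+ 5 * den5 t + den5 t ^+ 2.
Proof. by rewrite /den6 /den5; ring. Qed.

(** * The normal form of A and B and their commutator *)

Section FieldForms.
Variable K : fieldType.
Implicit Types t l c d e : K.

(* Normal form of a pair of matrices whose commutator is [diag(l, l^-1)]; the
   paper's [A] and [B] are of this form. *)
Definition pairA l d := mx22 (l * d) (l * d ^+ 2 - 1) 1 d.
Definition pairB l c e := mx22 (e / l) ((e ^+ 2 / l - 1) / c) c e.

Lemma det_pairA l d : \det (pairA l d) = 1.
Proof. by rewrite det2 !mx22E; ring. Qed.

Lemma det_pairB l c e : c != 0 -> \det (pairB l c e) = 1.
Proof. by move=> c0; rewrite det2 !mx22E mulrVK ?unitfE //; ring. Qed.

Lemma pair_commutator l c d e : l != 0 -> c != 0 ->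
  l * ((c * d) ^+ 2 - c * d * e + 1) = c ^+ 2 + e ^+ 2 - c * d * e ->
  pairA l d *m pairB l c e = mx22 l 0 0 l^-1 *m (pairB l c e *m pairA l d).
Proof.
move=> l0 c0 rel.
(* The off-diagonal entries agree identically; the diagonal ones differ by multiples of [r]. *)
pose r := l * ((c * d) ^+ 2 - c * d * e + 1) - (c ^+ 2 + e ^+ 2 - c * d * e).
have r0 k : r * k = 0 by rewrite /r rel subrr mul0r.
apply: mx22P; rewrite !mulmx2E !mx22E.
- by apply/subr0_eq; rewrite -[RHS](r0 c^-1) /r; field; rewrite l0 c0.
- by field; rewrite l0 c0.
- by field; rewrite l0.
- by apply/subr0_eq; rewrite -[RHS](r0 (- (l * c)^-1)) /r; field; rewrite l0 c0.
Qed.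

Section Specialization.
Variable t : K.
Hypothesis char2 : 2%:R = 0 :> K.
Hypotheses (p2 : den2 t != 0) (p5 : den5 t != 0) (p6 : den6 t != 0) (p7 : den7 t != 0).

(** The solution l of the commutator relation, as the quotient of the expressions in [den7E] and
    [den6E]. *)
Definition eigen := den7 t * den5 t / den6 t.

Lemma eigen_neq0 : eigen != 0.
Proof. by rewrite !mulf_neq0 ?invr_eq0. Qed.

Lemma pairA_E : pairA eigen (t ^+ 3 / (den5 t * den2 t)) =
  mx22 (numA00 t / den6 t) (numA01 t / denA t) 1 (t ^+ 3 / (den5 t * den2 t)).
Proof.
have e : eigen * (t ^+ 3 / (den5 t * den2 t)) = numA00 t / den6 t.
  have -> : numA00 t = t ^+ 3 * den7 t / den2 t by rewrite -numA00E // mulfK.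
  by rewrite /eigen; field; rewrite p2 p5 p6.
rewrite /pairA [_ ^+ 2 in X in X - 1]expr2 [X in X - 1]mulrA e; congr mx22.
rewrite numA01E // /denA; move: (numA00 t) => a.
by field; rewrite p2 p5 p6.
Qed.

Lemma pairB_E : pairB eigen (den2 t) (t ^+ 2) =
  mx22 (numB00 t / (den7 t * den5 t)) (numB01 t / denB t) (den2 t) (t ^+ 2).
Proof.
have -> : numB00 t = t ^+ 2 * den6 t by rewrite /numB00 /den6; ring.
rewrite numB01E // /denB /pairB /eigen.
by congr mx22; field; rewrite ?p2 ?p5 ?p6 ?p7.
Qed.

Lemma pair_relation : let d := t ^+ 3 / (den5 t * den2 t) in
  let c := den2 t in let e := t ^+ 2 in
  eigen * ((c * d) ^+ 2 - c * d * e + 1) = c ^+ 2 + e ^+ 2 - c * d * e.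
Proof.
move=> d c e; rewrite /eigen.
have -> : c * d = t ^+ 3 / den5 t by rewrite /c /d; field; rewrite p2 p5.
have -> : c ^+ 2 + e ^+ 2 - t ^+ 3 / den5 t * e = den7 t / den5 t.
  by rewrite den7E // /c /e; field.
have -> : (t ^+ 3 / den5 t) ^+ 2 - t ^+ 3 / den5 t * e + 1 = den6 t / den5 t ^+ 2.
  by rewrite den6E /e; field.
by field; rewrite p5 p6.
Qed.

Lemma intA_E : intA t = denA t *: pairA eigen (t ^+ 3 / (den5 t * den2 t)).
Proof.
rewrite pairA_E; apply: mx22P; rewrite [RHS]mxE !mx22E /denA.
all: by field; rewrite ?p2 ?p5 ?p6.
Qed.

Lemma intB_E : intB t = denB t *: pairB eigen (den2 t) (t ^+ 2).
Proof.
rewrite pairB_E; apply: mx22P; rewrite [RHS]mxE !mx22E /denB.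
all: by field; rewrite ?p2 ?p5 ?p7.
Qed.

End Specialization.
End FieldForms.

Lemma map_intL (R S : comNzRingType) (f : {rmorphism R -> S}) (t : R) l :
  map_mx f (intL t l) = intL (f t) l.
Proof.
have map_adj (M : 'M[R]_2) : map_mx f (adj22 M) = adj22 (map_mx f M).
  by apply: mx22P; rewrite !mxE /= ?rmorphN.
have morph := (rmorphM, rmorphD, rmorphXn, rmorph1).
have mapA : map_mx f (intA t) = intA (f t).
  by apply: mx22P; rewrite [LHS]mxE !mx22E /numA00 /numA01 /denA /den2 /den5 /den6 !morph.
have mapB : map_mx f (intB t) = intB (f t).
  by apply: mx22P; rewrite [LHS]mxE !mx22E /numB00 /numB01 /denB /den2 /den5 /den7 !morph.
by rewrite /intL; case: l => [[] []] /=; rewrite ?map_adj ?mapA ?mapB.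
Qed.

Lemma adj22Z (R : comNzRingType) (k : R) (M : 'M[R]_2) : adj22 (k *: M) = k *: adj22 M.
Proof. by apply: mx22P; rewrite !mxE /= ?mulrN. Qed.

Lemma invmx_adj22 (R : comUnitRingType) (M : 'M[R]_2) : \det M = 1 -> invmx M = adj22 M.
Proof.
move=> d1; have uM : M \in unitmx by rewrite unitmxE d1 unitr1.
by rewrite -[RHS](mulmxK uM) mul_adj22 d1 mul1mx.
Qed.

(** * Conjugation by diag(1, y) *)

Section DiagonalConjugation.
Variables (K : fieldType) (y : K).
Hypothesis y0 : y != 0.

Lemma det_diag1 : \det (mx22 1 0 0 y) = y.
Proof. by rewrite det2 !mx22E mul1r mul0r subr0. Qed.

Lemma diag1_unit : mx22 1 0 0 y \in unitmx.
Proof. by rewrite unitmxE det_diag1 unitfE. Qed.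

Lemma invmx_diag1 : invmx (mx22 1 0 0 y) = mx22 1 0 0 y^-1.
Proof.
suff e : mx22 1 0 0 y *m mx22 1 0 0 y^-1 = 1%:M.
  by rewrite -[RHS](mulKmx diag1_unit) e mulmx1.
apply: mx22P; rewrite mulmx2E !mx22E [RHS]mxE.
- by rewrite mulr0 addr0 mulr1.
- by rewrite mulr0 mul0r addr0.
- by rewrite mul0r mulr0 addr0.
- by rewrite mul0r add0r mulfV.
Qed.

Lemma diag1_conj (M : 'M[K]_2) : mx22 1 0 0 y *m M *m invmx (mx22 1 0 0 y) =
  mx22 (M 0 0) (M 0 1 / y) (y * M 1 0) (M 1 1).
Proof.
by rewrite invmx_diag1; apply: mx22P; rewrite !mulmx2E !mx22E; field.
Qed.

End DiagonalConjugation.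

(** * The representation over any field containing F_2[x][y] *)

Section Representation.
Local Notation Px := {poly 'F_2}.
Variables (K : fieldType) (phi : {rmorphism {poly Px} -> K}).
Hypothesis phi_inj : injective phi.

Let x := phi 'X%:P.
Let y := phi 'X.

Definition emb : {rmorphism Px -> K} := phi \o polyC.

Lemma emb_eq0 (p : Px) : (emb p == 0) = (p == 0).
Proof. by rewrite -(rmorph0 emb) /= (inj_eq phi_inj) (inj_eq (@polyC_inj _)). Qed.

Lemma two_eq0 : 2%:R = 0 :> K.
Proof.
have <- : emb 2%:R = 2%:R by rewrite rmorph_nat.
by apply/eqP; rewrite emb_eq0 -polyC_natr polyC_eq0.
Qed.

Let den_neq0 (d : forall R : comNzRingType, R -> R) (n : nat) :
  emb (d _ 'X) = d _ x -> size (d _ 'X : Px) = n.+1 -> d _ x != 0.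
Proof. by move=> <- dn; rewrite emb_eq0 -size_poly_gt0 dn. Qed.

Lemma den2_neq0 : den2 x != 0.
Proof.
by apply: (den_neq0 (d := den2)) (size_den2 _);
  rewrite /den2 !(rmorphD, rmorphXn, rmorph1).
Qed.
Lemma den5_neq0 : den5 x != 0.
Proof.
by apply: (den_neq0 (d := den5)) (size_den5 _);
  rewrite /den5 !(rmorphD, rmorphXn, rmorph1).
Qed.
Lemma den6_neq0 : den6 x != 0.
Proof.
by apply: (den_neq0 (d := den6)) (size_den6 _);
  rewrite /den6 !(rmorphD, rmorphXn, rmorph1).
Qed.
Lemma den7_neq0 : den7 x != 0.
Proof.
by apply: (den_neq0 (d := den7)) (size_den7 _);
  rewrite /den7 !(rmorphD, rmorphXn, rmorph1).
Qed.

Let lam := eigen x.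
Let lam_neq0 : lam != 0 := eigen_neq0 den5_neq0 den6_neq0 den7_neq0.

Lemma y_neq0 : y != 0.
Proof. by rewrite -(rmorph0 phi) (inj_eq phi_inj) polyX_eq0. Qed.

Let T := mx22 1 0 0 y.
Let T_unit : T \in unitmx := diag1_unit y_neq0.

Definition mat_gen (t g : bool) : 'M[K]_2 :=
  let M := if g then pairB lam (den2 x) (x ^+ 2)
           else pairA lam (x ^+ 3 / (den5 x * den2 x)) in
  if t then T *m M *m invmx T else M.

Lemma det_mat_gen t g : \det (mat_gen t g) == 1.
Proof.
have d1 : \det (mat_gen false g) = 1.
  by case: g; rewrite /mat_gen ?det_pairA ?det_pairB ?den2_neq0.
case: t; last by rewrite d1.
by rewrite !det_mulmx d1 mulr1 det_inv mulfV // -unitfE -unitmxE T_unit.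
Qed.

Definition sl_gen t g : SL 2 K := MkSL (det_mat_gen t g).

Lemma SL_val_mul (M N : SL 2 K) : SLval (M * N)%g = SLval M *m SLval N.
Proof. by []. Qed.
Lemma SL_val_inv (M : SL 2 K) : SLval M^-1%g = invmx (SLval M).
Proof. by []. Qed.

Lemma sl_gen_conj w :
  SLval (evalw (sl_gen true) w) = T *m SLval (evalw (sl_gen false) w) *m invmx T.
Proof.
have conjK (M N : 'M[K]_2) :
    T *m M *m invmx T *m (T *m N *m invmx T) = T *m (M *m N) *m invmx T.
  by rewrite -!mulmxA (mulKmx T_unit).
have conj_letter l : SLval (evall (sl_gen true) l) =
    T *m SLval (evall (sl_gen false) l) *m invmx T.
  case: l => g []; rewrite // /evall [LHS]SL_val_inv [in RHS]SL_val_inv.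
  have e : SLval (sl_gen true g) *m
      (T *m invmx (SLval (sl_gen false g)) *m invmx T) = 1%:M.
    by rewrite [LHS]conjK (mulmxV (SL_unitmx (sl_gen false g))) mulmx1 (mulmxV T_unit).
  by rewrite -[RHS](mulKmx (SL_unitmx (sl_gen true g))) e mulmx1.
elim: w => [|l w IH]; first by rewrite /= mulmx1 (mulmxV T_unit).
by rewrite [LHS]SL_val_mul [in RHS]SL_val_mul conj_letter IH conjK.
Qed.

(** Clearing denominators loses a nonzero factor, which affects neither being scalar nor the
    vanishing of an entry. *)
Definition scaled (k : K) (N M : 'M[K]_2) := k != 0 /\ N = k *: M.

Lemma emb_intL l : exists k,
  scaled k (map_mx emb (intL 'X l)) (SLval (evall (sl_gen false) l)).
Proof.
have [kA eA] : exists k, scaled k (intA x) (mat_gen false false).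
  exists (denA x); split; first by rewrite !mulf_neq0 ?den2_neq0 ?den5_neq0 ?den6_neq0.
  exact: (intA_E two_eq0 den2_neq0 den5_neq0 den6_neq0).
have [kB eB] : exists k, scaled k (intB x) (mat_gen false true).
  exists (denB x); split; first by rewrite !mulf_neq0 ?den2_neq0 ?den5_neq0 ?den7_neq0.
  exact: (intB_E two_eq0 den2_neq0 den5_neq0 den6_neq0 den7_neq0).
have [k [k0 ek]] : exists k, scaled k (intL x (l.1, false)) (mat_gen false l.1).
  by case: (l.1); [exists kB | exists kA].
exists k; split=> //; rewrite map_intL; case: l ek => g [] // ek.
rewrite [SLval _]SL_val_inv invmx_adj22 ?det_SL // -adj22Z -ek.
by [].
Qed.

Lemma emb_intW w :
  exists k, scaled k (map_mx emb (intW _ w)) (SLval (evalw (sl_gen false) w)).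
Proof.
elim: w => [|l w [k [k0 ek]]].
  by exists 1; split; rewrite ?oner_neq0 // scale1r map_mx1.
have [m [m0 em]] := emb_intL l; exists (m * k); split; first by rewrite mulf_neq0.
by rewrite /= map_mxM em ek -scalemxAl -scalemxAr scalerA.
Qed.

Lemma phi_lift22 t w : exists k,
  scaled k (map_mx phi (lift22 t (intW _ w))) (SLval (evalw (sl_gen t) w)).
Proof.
have [k [k0 ek]] := emb_intW w; case: t; last first.
  by exists k; split=> //; rewrite -ek -map_mx_comp.
(* The extra [y] is the factor with which [lift22] clears the 1/y of the conjugation. *)
exists (y * k); split; first by rewrite mulf_neq0 ?y_neq0.
rewrite sl_gen_conj -scalerA [k *: _]scalemxAl
  [k *: (T *m _)]scalemxAr -ek diag1_conj ?y_neq0 //.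
have yy : y / y = 1 by rewrite mulfV // y_neq0.
apply: mx22P; rewrite [LHS]mxE [RHS]mxE !mx22E !mxE /= ?rmorphM ?rmorphXn -?/y.
- by rewrite mulrC.
- by rewrite mulrCA yy mulr1.
- by rewrite mulrC mulrA.
- by rewrite mulrC.
Qed.

Definition int_syl (s : seq (bool * word bool)) : seq (bool * 'M[Px]_2) :=
  [seq (z.1, intW _ z.2) | z <- s].

Lemma phi_lift_prod s : exists k,
  scaled k (map_mx phi (lift_prod (int_syl s))) (SLval (syl_val sl_gen s)).
Proof.
elim: s => [|[t w] s [k [k0 ek]]].
  by exists 1; split; rewrite ?oner_neq0 // scale1r map_mx1.
have [m [m0 em]] := phi_lift22 t w; exists (m * k); split; first by rewrite mulf_neq0.
by rewrite /= map_mxM em ek -scalemxAl -scalemxAr scalerA.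
Qed.

Lemma scalar_of_phi (N : 'M[{poly Px}]_2) k : map_mx phi N = k%:M -> N = (N 0 0)%:M.
Proof.
move=> /matrixP e; apply: mx22P; rewrite [RHS]mxE //=; apply: phi_inj.
- by have := e 0 1; rewrite !mxE rmorph0.
- by have := e 1 0; rewrite !mxE rmorph0.
- by have := e 1 1; have := e 0 0; rewrite !mxE /= => -> ->.
Qed.

Lemma scalar_of_emb (N : 'M[Px]_2) k : map_mx emb N = k%:M -> N = (N 0 0)%:M.
Proof.
move=> e; have /scalar_of_phi : map_mx phi (map_mx polyC N) = k%:M.
  by rewrite -e -map_mx_comp.
move=> /matrixP eN; apply: mx22P; rewrite [RHS]mxE //=; apply: polyC_inj.
- by have := eN 0 1; rewrite !mxE.
- by have := eN 1 0; rewrite !mxE.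
- by have := eN 1 1; rewrite !mxE.
Qed.

(** The commutator is diagonal, hence unchanged under conjugation by T; this yields [A, B] =
    [D, C]. *)
Lemma sl_gen_comm t :
  SLval (evalw (sl_gen t) (comm_word false)) = mx22 lam 0 0 lam^-1.
Proof.
have key : SLval (evalw (sl_gen false) (comm_word false)) = mx22 lam 0 0 lam^-1.
  pose A := sl_gen false false; pose B := sl_gen false true.
  have AB : SLval A *m SLval B = mx22 lam 0 0 lam^-1 *m (SLval B *m SLval A).
    apply: pair_commutator => //; first exact: den2_neq0.
    by apply: pair_relation; rewrite ?two_eq0 ?den2_neq0 ?den5_neq0 ?den6_neq0.
  rewrite -[LHS]/(SLval A *m (SLval B *m (invmx (SLval A) *m (invmx (SLval B) *m 1%:M)))).
  rewrite mulmx1 mulmxA AB -!mulmxA (mulKVmx (SL_unitmx A)).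
  by rewrite (mulmxV (SL_unitmx B)) mulmx1.
case: t => //; rewrite sl_gen_conj key diag1_conj ?y_neq0 //.
by rewrite !mx22E mul0r mulr0.
Qed.

Lemma evalw_comm_word_true (G : groupType) (h : bool -> G) :
  evalw h (comm_word true) = ((evalw h (comm_word false))^-1)%g.
Proof. by rewrite -evalw_inv. Qed.

Lemma intW_comm_word g : intW 'F_2 (comm_word g) (idx (~~ g)) (idx g) = 0.
Proof.
have [k [_ ek]] := emb_intW (comm_word g); apply/eqP; rewrite -emb_eq0.
have := congr1 (fun N : 'M_2 => N (idx (~~ g)) (idx g)) ek.
rewrite mxE => ->; rewrite mxE; case: g {ek}; last by rewrite sl_gen_comm mx22E mulr0.
rewrite evalw_comm_word_true SL_val_inv invmx_adj22 ?det_SL // sl_gen_comm.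
by rewrite !mx22E oppr0 mulr0.
Qed.

(** * Triviality of the kernel *)

Section Faithfulness.
Variables (G : groupType) (h : bool -> bool -> G) (f : G -> SL 2 K).
Hypothesis fM : {morph f : a b / (a * b)%g}.
Hypothesis f_gen : forall t g, f (h t g) = sl_gen t g.
Hypothesis h_comm :
  evalw (h false) (comm_word false) = evalw (h true) (comm_word false).

Let f_evalw t w : f (evalw (h t) w) = evalw (sl_gen t) w.
Proof.
rewrite evalw_morph //; elim: w => //= -[g e] w ->.
by rewrite /evall /= f_gen.
Qed.

Let f_syl s : f (syl_val h s) = syl_val sl_gen s.
Proof.
elim: s => [|[t w] s IH] /=; last by rewrite fM f_evalw IH.
by apply: (mulgI (f 1%g)); rewrite -fM !mulg1.
Qed.

Lemma kernel_trivial s :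
  all (fun z => reduced z.2) s -> f (syl_val h s) = 1%g -> syl_val h s = 1%g.
Proof.
apply: (syl_val_trivial (P := fun a => f a = 1%g)) => {s} [t w red|s s0 red nam alt].
  (* One syllable: once the conjugation by T is undone, freeness of A and B applies. *)
  rewrite f_evalw => /(congr1 (@SLval _ _)) ew.
  have {}ew : SLval (evalw (sl_gen false) w) = 1%:M.
    case: t ew => //; rewrite sl_gen_conj => ew.
    rewrite -(mulKmx T_unit (SLval _)) -[X in _ *m X](mulmxKV T_unit) ew.
    by rewrite mul1mx mulVmx ?T_unit.
  have [k [_ ek]] := emb_intW w; rewrite ew scalemx1 in ek.
  exact: intW_not_scalar red (scalar_of_emb ek).
(* Alternating product: a trivial image would make the lifted product scalar, against the growth of
   its degree in y. *)
rewrite f_syl => /(congr1 (@SLval _ _)) es.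
have [k [_ ek]] := phi_lift_prod s; rewrite es scalemx1 in ek.
suff : lift_prod (int_syl s) != (lift_prod (int_syl s) 0 0)%:M.
  by move=> /eqP; apply; exact: scalar_of_phi ek.
apply: lift_prod_not_scalar.
- by case: (s) s0.
- have h_commE g : evalw (h false) (comm_word g) = evalw (h true) (comm_word g).
    by case: g; rewrite // !evalw_comm_word_true h_comm.
  rewrite all_map; apply/allP => -[t w] zs.
  have := intW_offdiag_neq0 h_commE intW_comm_word (allP red _ zs) (allP nam _ zs) (~~ t).
  by rewrite negbK.
- by rewrite sorted_map; exact: sub_sorted alt.
Qed.

End Faithfulness.
End Representation.

(** * The surface group and F_2(x, y) *)

Lemma evalw_comm_val (K : fieldType) (h : bool -> SL 2 K) :
  SLval (evalw h (comm_word false)) = SLval (h false) *m SLval (h true) *m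
    invmx (SLval (h false)) *m invmx (SLval (h true)).
Proof.
have E (a b : SL 2 K) : SLval (a * (b * (a^-1 * (b^-1 * 1))))%g =
    SLval a *m SLval b *m invmx (SLval a) *m invmx (SLval b).
  by rewrite !SL_val_mul mulmx1 !mulmxA.
exact: E.
Qed.

Lemma tofrac_inj (R : idomainType) : injective (@tofrac R).
Proof. by move=> p q /eqP; rewrite tofrac_eq => /eqP. Qed.

Lemma matA_gen : matA = mat_gen (@tofrac _) false false.
Proof.
have inj := @tofrac_inj {poly {poly 'F_2}}.
rewrite /mat_gen (pairA_E (two_eq0 inj) (den2_neq0 inj) (den5_neq0 inj) (den6_neq0 inj)).
rewrite /numA00 /numA01 /denA /den2 /den5 /den6 -/varx; reflexivity.
Qed.

Lemma matB_gen : matB = mat_gen (@tofrac _) false true.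
Proof.
have inj := @tofrac_inj {poly {poly 'F_2}}.
rewrite /mat_gen (pairB_E (two_eq0 inj) (den2_neq0 inj) (den5_neq0 inj) (den6_neq0 inj)
  (den7_neq0 inj)).
rewrite /numB00 /numB01 /denB /den2 /den5 /den7 -/varx; reflexivity.
Qed.

Lemma matD_gen : matD = mat_gen (@tofrac _) true false.
Proof. by rewrite /matD matA_gen. Qed.

Lemma matC_gen : matC = mat_gen (@tofrac _) true true.
Proof. by rewrite /matC matB_gen. Qed.

Definition sl_F2xy := sl_gen (@tofrac_inj {poly {poly 'F_2}}).

Lemma sl_F2xy_comm :
  evalw (sl_F2xy false) (comm_word false) = evalw (sl_F2xy true) (comm_word false).
Proof. by apply: val_inj; rewrite [LHS]sl_gen_comm [RHS]sl_gen_comm. Qed.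

Definition side (i : 'I_4) : bool := (1 < i)%N.
(** The relator reads [a, b] = [d, c], so d corresponds to a and c to b. *)
Definition kind (i : 'I_4) : bool := (i == 1 :> nat) || (i == 2 :> nat).
Definition of_side (t g : bool) : 'I_4 :=
  if t then if g then gen_c else gen_d else if g then gen_b else gen_a.

Lemma of_sideK i : of_side (side i) (kind i) = i.
Proof. by case: i => [[|[|[|[|]]]]] //= lt_i4; apply: val_inj. Qed.

Definition S2_side t g : S2 := S2_gen (of_side t g).
Definition sl_S2_gen (i : 'I_4) := sl_F2xy (side i) (kind i).

Lemma sl_S2_of_side t g : sl_S2_gen (of_side t g) = sl_F2xy t g.
Proof. by case: t g => [] []. Qed.

Lemma evalw_S2_relator (G : groupType) (k : 'I_4 -> G) :
  (evalw k S2_relator = evalw (k \o of_side false) (comm_word false) *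
    (evalw (k \o of_side true) (comm_word false))^-1)%g.
Proof.
have -> : S2_relator = [seq (of_side false l.1, l.2) | l <- comm_word false] ++
    [seq (of_side true l.1, l.2) | l <- comm_word true] by [].
by rewrite evalw_cat !evalw_map evalw_comm_word_true.
Qed.

Lemma evalw_S2_gen w : evalw S2_gen w = pclass [:: S2_relator] w.
Proof. exact: evalw_presented. Qed.

Lemma S2_side_comm :
  evalw (S2_side false) (comm_word false) = evalw (S2_side true) (comm_word false).
Proof.
apply/eqP; rewrite -divg_eq1; apply/eqP.
rewrite -[LHS](evalw_S2_relator S2_gen) evalw_S2_gen; apply/pclassP.
rewrite -[S2_relator]cats0 -[S2_relator ++ _]cat0s.
by apply: word_eq_relator; rewrite mem_head.
Qed.

Lemma sl_S2_word_eq u w : word_eq [:: S2_relator] u w ->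
  evalw sl_S2_gen u = evalw sl_S2_gen w.
Proof.
apply: evalw_word_eq => r; rewrite inE => /eqP->; rewrite evalw_S2_relator.
have e t : evalw (sl_S2_gen \o of_side t) (comm_word false) =
    evalw (sl_F2xy t) (comm_word false) by case: t.
by rewrite !e sl_F2xy_comm mulgV.
Qed.

Definition S2_rep (p : S2) : SL 2 F2xy := evalw sl_S2_gen (repr p).

Lemma S2_rep_pclass w : S2_rep (pclass _ w) = evalw sl_S2_gen w.
Proof. by apply: sl_S2_word_eq; apply/pclassP; rewrite pclass_repr. Qed.

Lemma S2_repM : {morph S2_rep : p q / (p * q)%g}.
Proof. by move=> p q; rewrite S2_rep_pclass evalw_cat. Qed.

HB.instance Definition _ := isMultiplicative.Build S2 (SL 2 F2xy) S2_rep S2_repM.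

Lemma S2_rep_gen i : S2_rep (S2_gen i) = sl_S2_gen i.
Proof. by rewrite S2_rep_pclass /= mulg1. Qed.

Lemma S2_rep_kernel p : S2_rep p = 1%g -> p = 1%g.
Proof.
(* Each letter is taken as a syllable of its own, which is trivially reduced. *)
pose syl (l : 'I_4 * bool) := (side l.1, [:: (kind l.1, l.2)]).
have -> : p = syl_val S2_side (map syl (repr p)).
  rewrite -{1}(pclass_repr p) -evalw_S2_gen; elim: (repr p) => //= -[i e] w ->.
  by rewrite mulg1 /evall /S2_side /= of_sideK.
have f_gen t g : S2_rep (S2_side t g) = sl_gen (@tofrac_inj _) t g.
  by rewrite S2_rep_gen sl_S2_of_side.
apply: (kernel_trivial S2_repM f_gen S2_side_comm).
by apply/allP => _ /mapP[l _ ->].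
Qed.

Lemma S2_rep_inj : injective S2_rep.
Proof.
move=> p q epq; apply/eqP; rewrite -divg_eq1; apply/eqP/S2_rep_kernel.
by rewrite S2_repM epq -S2_repM mulgV /S2_rep; exact: S2_rep_pclass [::].
Qed.

Theorem corollary8p5 :
  [/\ \det matA = 1, \det matB = 1, \det matC = 1 & \det matD = 1] /\
  matA *m matB *m invmx matA *m invmx matB
    = matD *m matC *m invmx matD *m invmx matC /\
  exists f : {multiplicative S2 -> SL 2 F2xy},
    [/\ SLval (f (S2_gen gen_a)) = matA,
        SLval (f (S2_gen gen_b)) = matB,
        SLval (f (S2_gen gen_c)) = matC &
        SLval (f (S2_gen gen_d)) = matD] /\
    injective f.
Proof.
rewrite matA_gen matB_gen matC_gen matD_gen; split.
  by split; apply/eqP; exact: (det_mat_gen (@tofrac_inj _)).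
split.
  have := congr1 (@SLval _ _) sl_F2xy_comm.
  by rewrite [LHS]evalw_comm_val [RHS]evalw_comm_val.
exists S2_rep; split; last exact: S2_rep_inj.
have e t g : SLval (S2_rep (S2_gen (of_side t g))) = mat_gen (@tofrac _) t g.
  by rewrite S2_rep_gen sl_S2_of_side.
split; [exact: e false false | exact: e false true |
  exact: e true true | exact: e true false].
Qed.
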